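(* Let $\Omega\subset\mathbb{R}^n$, $f$, $f^*$ be as in the context, and let $\{D^{(k)}\}_{k\in\mathbb{N}_0}$ be a model-based sequence with thresholds $\{u^{(k)}\}$ and bound parameters $\{\omega_k\}$ (as defined in the context). Suppose $f$ is not a constant and there exists a sequence of positive real numbers $\{q_k\}$ such that for all $k\in\mathbb{N}_0$ $$u^{(k)}-\min\big(A_k^*,f^*_{\chi^{(k)}}\big)\le\frac{1}{1+q_k}\big(f^{**}_{\chi^{(k)}}-f^*_{\chi^{(k)}}\big),\qquad A_k^*=\min_{x\in D^{(k)}}\mathcal{A}^{(k)}f(x).$$ If the parameters $\omega_k$ satisfy $(1+\omega_k)^2<1+q_k$, then for all $k\in\mathbb{N}_0$, $$\max_{x\in D^{(k+1)}}[f(x)-f^*]\le\frac{(1+\omega_k)^2}{1+q_k}\max_{x\in D^{(k)}}[f(x)-f^*].$$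
   Context: Setting: $\Omega\subset\mathbb{R}^n$ is a (not necessarily convex) closed domain with $\max_{x,y\in\Omega}\|x-y\|_2\le 1$; $f:\Omega\to\mathbb{R}$ is continuous; $f^*=\min_{x\in\Omega}f(x)$. Quasi-uniformity: a finite set $\chi=\{\chi_i\}_{i=1}^N\subset D$ is quasi-uniform over $D$ with uniformity constant $\tau>0$ if $\frac1\tau q_\chi\le h_{D,\chi}\le\tau q_\chi$, where $h_{D,\chi}=\sup_{x\in D}\min_{i}\|x-\chi_i\|_2$ and $q_\chi=\frac12\min_{\chi_i\ne\chi_j}\|\chi_i-\chi_j\|_2$. Model-based sequence with varying bound parameter: given $\{\omega_k\}_{k\in\mathbb{N}_0}\subset(0,1]$, $\{D^{(k)}\}$ is defined recursively by $D^{(0)}=\Omega$ and $$D^{(k+1)}=\{x\in D^{(k)}:\mathcal{A}^{(k)}f(x)\le u^{(k)}\},$$ where $\chi^{(k)}=\{\chi^{(k)}_i\}$ is a finite set of $N^{(k)}$ points quasi-uniformly distributed over $D^{(k)}$ with $\chi^{(k)}\cap\chi^{(k+1)}=\chi^{(k)}\cap D^{(k+1)}$; $f^*_{\chi^{(k)}}=\min_i f(\chi^{(k)}_i)$ and $f^{**}_{\chi^{(k)}}=\max_i f(\chi^{(k)}_i)$; $u^{(k)}\in[f^*_{\chi^{(k)}},f^{**}_{\chi^{(k)}}]$; and $\mathcal{A}^{(k)}f:D^{(k)}\to\mathbb{R}$ is a continuous approximation of $f$ built from the data $(\chi^{(k)},f|_{\chi^{(k)}})$ satisfying $$\max_{x\in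 D^{(k)}}|\mathcal{A}^{(k)}f(x)-f(x)|\le\omega_k\,(u^{(k)}-f^*_{\chi^{(k)}}).$$ *)

(* Defs.v *)
From mathcomp Require Import all_boot all_order all_algebra.
From mathcomp Require Import finmap.
From mathcomp Require Import all_classical all_reals all_analysis.

Set Implicit Arguments.
Unset Strict Implicit.
Unset Printing Implicit Defensive.

Import Order.TTheory GRing.Theory Num.Theory.
Import numFieldNormedType.Exports.

Local Open Scope classical_set_scope.
Local Open Scope ring_scope.

(* The library norm on 'rV[R]_n is the max norm; its topology, which is the one
   used for closedness and continuity, is the Euclidean one. *)
Definition norm2 (R : realType) (n : nat) (x : 'rV[R]_n) : R :=
  Num.sqrt (\sum_(i < n) x ord0 i ^+ 2).

(* The maximum and the minimum of g over E when they are attained, as they are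
   on a nonempty compact E for g continuous on E (maxon_attained and
   minon_attained below), in particular on a nonempty finite E. *)
Definition maxon (R : realType) (T : Type) (g : T -> R) (E : set T) : R :=
  sup (g @` E).

Definition minon (R : realType) (T : Type) (g : T -> R) (E : set T) : R :=
  inf (g @` E).

Lemma maxon_attained (R : realType) (n : nat) (g : 'rV[R]_n -> R)
    (E : set 'rV[R]_n) :
  E !=set0 -> compact E -> {within E, continuous g} ->
  exists2 x, E x & maxon g E = g x.
Proof.
move=> E0 cE cg; have [x /set_mem Ex xmax] := compact_EVT_max E0 cE cg.
have ub : ubound (g @` E) (g x) by move=> _ [y Ey <-]; exact/xmax/mem_set.
exists x => //; apply/eqP; rewrite eq_le; apply/andP; split.
  by apply: ge_sup => //; exact: image_nonempty.
by apply: ub_le_sup; [exists (g x) | exists x].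
Qed.

Lemma minon_attained (R : realType) (n : nat) (g : 'rV[R]_n -> R)
    (E : set 'rV[R]_n) :
  E !=set0 -> compact E -> {within E, continuous g} ->
  exists2 x, E x & minon g E = g x.
Proof.
move=> E0 cE cg; have [x /set_mem Ex xmin] := compact_EVT_min E0 cE cg.
have lb : lbound (g @` E) (g x) by move=> _ [y Ey <-]; exact/xmin/mem_set.
exists x => //; apply/eqP; rewrite eq_le; apply/andP; split.
  by apply: ge_inf; [exists (g x) | exists x].
by apply: lb_le_inf => //; exact: image_nonempty.
Qed.

Definition fill_distance (R : realType) (n : nat) (D : set 'rV[R]_n)
    (chi : {fset 'rV[R]_n}) : R :=
  sup [set minon (fun y => norm2 (x - y)) [set` chi] | x in D].

(* Since inf set0 = 0, this is 0 when chi has a single point; such a chi is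
   then quasi-uniform over D only if D = chi. *)
Definition separation_radius (R : realType) (n : nat)
    (chi : {fset 'rV[R]_n}) : R :=
  2^-1 * minon (fun p => norm2 (p.1 - p.2))
    [set p : 'rV[R]_n * 'rV[R]_n |
      [/\ p.1 \in chi, p.2 \in chi & p.1 != p.2]].

Definition quasi_uniform (R : realType) (n : nat) (D : set 'rV[R]_n)
    (tau : R) (chi : {fset 'rV[R]_n}) : Prop :=
  [/\ [set` chi] !=set0, [set` chi] `<=` D,
      tau^-1 * separation_radius chi <= fill_distance D chi &
      fill_distance D chi <= tau * separation_radius chi].

Definition samples (R : realType) (n : nat) (f : 'rV[R]_n -> R)
    (chi : {fset 'rV[R]_n}) : {fset 'rV[R]_n * R} :=
  [fset (x, f x) | x in chi]%fset.

(* A k sends a finite data set of (point, value) pairs to a function, so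
   A k (samples f (chi k)) is the approximation of f built from its values on
   chi k; it is only ever considered on D k. *)
Record model_based_sequence (R : realType) (n : nat) (Omega : set 'rV[R]_n)
    (f : 'rV[R]_n -> R) (omega : nat -> R) (D : nat -> set 'rV[R]_n)
    (chi : nat -> {fset 'rV[R]_n}) (u : nat -> R)
    (A : nat -> {fset 'rV[R]_n * R} -> 'rV[R]_n -> R) : Prop := {
  mbs_omega : forall k, 0 < omega k <= 1;
  mbs_init : D 0%N = Omega;
  mbs_rec : forall k,
    D k.+1 = [set x | D k x /\ A k (samples f (chi k)) x <= u k];
  mbs_quasi_uniform : forall k,
    exists2 tau : R, 0 < tau & quasi_uniform (D k) tau (chi k);
  mbs_nested : forall k,
    [set` chi k] `&` [set` chi k.+1] = [set` chi k] `&` D k.+1;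
  mbs_threshold : forall k,
    minon f [set` chi k] <= u k <= maxon f [set` chi k];
  mbs_continuous : forall k,
    {within D k, continuous (A k (samples f (chi k)))};
  mbs_error : forall k,
    maxon (fun x => `|A k (samples f (chi k)) x - f x|) (D k)
      <= omega k * (u k - minon f [set` chi k])
}.

(* Main.v *)
Require Import Defs.
From mathcomp Require Import all_boot all_order all_algebra.
From mathcomp Require Import finmap.
From mathcomp Require Import all_classical all_reals all_analysis.
From mathcomp Require Import lra.

Import Order.TTheory GRing.Theory Num.Theory.
Import numFieldNormedType.Exports.

Local Open Scope classical_set_scope.
Local Open Scope ring_scope.

(** Let xs be a global minimizer of f, m the smallest sample and A* the minimum
    of the model, at step k. The error bound with omega <= 1 keeps xs in every
    D k, so A* - omega (u - m) <= f xs, and f <= u + omega (u - m) on D k.+1.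
    Hence on D k.+1, with B = min (A*, m),
      f - f xs <= (u - B) + 2 omega (u - m) <= (1 + 2 omega) (u - B),
    and the threshold hypothesis bounds u - B by the sample oscillation over
    1 + q, which is at most the maximum of f - f xs on D k over 1 + q. *)

Set Implicit Arguments.
Unset Strict Implicit.

Lemma ler_coord_norm2 (R : realType) (n : nat) (x : 'rV[R]_n) (i : 'I_n) :
  `|x ord0 i| <= norm2 x.
Proof.
rewrite -sqrtr_sqr ler_wsqrtr// (bigD1 i)//= lerDl.
by apply: sumr_ge0 => j _; exact: sqr_ge0.
Qed.

(** Each coordinate of [x - x0] is at most [norm2 (x - x0)] in absolute value, so [E] sits in a box
    of half-width [r] around any of its points [x0]; the box is compact as a product of segments. *)
Lemma closed_norm2_bounded_compact (R : realType) (n : nat)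
    (E : set 'rV[R]_n) (r : R) :
  closed E -> (forall x y, E x -> E y -> norm2 (x - y) <= r) -> compact E.
Proof.
move=> clE diamE; have [->|/set0P[x0 Ex0]] := eqVneq E set0.
  exact: compact0.
apply: (subclosed_compact clE
  (@rV_compact _ _ (fun i => `[x0 ord0 i - r, x0 ord0 i + r]%classic) _)).
  by move=> i; exact: segment_compact.
move=> x Ex i /=; rewrite in_itv /= -ler_distl.
by have := le_trans (ler_coord_norm2 (x - x0) i) (diamE _ _ Ex Ex0); rewrite !mxE.
Qed.

Lemma within_continuous_closed_sublevel (T : topologicalType) (R : realType)
    (E : set T) (g : T -> R) (c : R) :
  closed E -> {within E, continuous g} -> closed [set x | E x /\ g x <= c].
Proof.
move=> clE cg; have -> : [set x | E x /\ g x <= c] = E `&` g @^-1` [set y | y <= c].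
  by [].
(* As [E] is closed, being closed in the subspace [E] amounts to having an ambiently closed trace on
   [E]. *)
rewrite (@closed_setSI _ E (g @^-1` [set y | y <= c])) //.
exact: (closed_comp (fun x _ => cg x) (@closed_le R c)).
Qed.

Lemma compact_has_ubound_image (T : topologicalType) (R : realType) (E : set T)
    (g : T -> R) :
  compact E -> {within E, continuous g} -> has_ubound (g @` E).
Proof.
move=> cE cg; have [->|/set0P E0] := eqVneq E set0.
  by rewrite image_set0; exists 0.
have [x _ xmax] := compact_EVT_max E0 cE cg.
by exists (g x) => _ [y Ey <-]; exact/xmax/mem_set.
Qed.

Lemma compact_has_lbound_image (T : topologicalType) (R : realType) (E : set T)
    (g : T -> R) :
  compact E -> {within E, continuous g} -> has_lbound (g @` E).
Proof.
move=> cE cg; have [->|/set0P E0] := eqVneq E set0.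
  by rewrite image_set0; exists 0.
have [x _ xmin] := compact_EVT_min E0 cE cg.
by exists (g x) => _ [y Ey <-]; exact/xmin/mem_set.
Qed.

(** On an unbounded set [sup] is a default value; compactness and continuity make [maxon] a genuine
    upper bound. *)
Lemma maxon_ge (T : topologicalType) (R : realType) (E : set T) (g : T -> R) x :
  compact E -> {within E, continuous g} -> E x -> g x <= maxon g E.
Proof.
move=> cE cg Ex; apply: ub_le_sup; last by exists x.
exact: compact_has_ubound_image.
Qed.

Lemma minon_le (T : topologicalType) (R : realType) (E : set T) (g : T -> R) x :
  compact E -> {within E, continuous g} -> E x -> minon g E <= g x.
Proof.
move=> cE cg Ex; apply: ge_inf; last by exists x.
exact: compact_has_lbound_image.
Qed.

(** Nonemptiness matters: [sup set0 = 0] would exceed a negative [c]. *)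
Lemma maxon_le (T : Type) (R : realType) (E : set T) (g : T -> R) (c : R) :
  E !=set0 -> (forall x, E x -> g x <= c) -> maxon g E <= c.
Proof.
move=> E0 gc; apply: ge_sup; first exact: image_nonempty.
by move=> _ [x Ex <-]; exact: gc.
Qed.

Lemma minon_ge (T : Type) (R : realType) (E : set T) (g : T -> R) (c : R) :
  E !=set0 -> (forall x, E x -> c <= g x) -> c <= minon g E.
Proof.
move=> E0 gc; apply: lb_le_inf; first exact: image_nonempty.
by move=> _ [x Ex <-]; exact: gc.
Qed.

Section ModelBasedSequence.
Context (R : realType) (n : nat) (Omega : set 'rV[R]_n) (f : 'rV[R]_n -> R)
  (omega : nat -> R) (D : nat -> set 'rV[R]_n) (chi : nat -> {fset 'rV[R]_n})
  (u : nat -> R) (A : nat -> {fset 'rV[R]_n * R} -> 'rV[R]_n -> R).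
Hypothesis Omega_compact : compact Omega.
Hypothesis f_continuous : {within Omega, continuous f}.
Hypothesis D_model : model_based_sequence Omega f omega D chi u A.

Local Notation model k := (A k (samples f (chi k))).
Local Notation fmin k := (minon f [set` chi k]).

Lemma mbs_sub k : D k `<=` Omega.
Proof.
elim: k => [|k IHk]; first by rewrite (mbs_init D_model).
by rewrite (mbs_rec D_model) => x [/IHk].
Qed.

(** By induction from [Omega], each [D k.+1] is closed as a sublevel set of a continuous model on
    the closed set [D k]. *)
Lemma mbs_compact k : compact (D k).
Proof.
apply: (subclosed_compact _ Omega_compact (@mbs_sub k)).
elim: k => [|k IHk].
  by rewrite (mbs_init D_model); exact: compact_closed (@norm_hausdorff _ _) _.
rewrite (mbs_rec D_model); apply: within_continuous_closed_sublevel => //.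
exact: (mbs_continuous D_model).
Qed.

Lemma mbs_f_continuous k : {within D k, continuous f}.
Proof. exact: continuous_subspaceW (@mbs_sub k) f_continuous. Qed.

Lemma mbs_error_pointwise k x : D k x ->
  `|model k x - f x| <= omega k * (u k - fmin k).
Proof.
move=> Dx; apply: le_trans (mbs_error D_model k).
apply: (@maxon_ge _ _ _ (fun x => `|model k x - f x|)) Dx; first exact: mbs_compact.
move=> y; apply: cvg_norm; apply: cvgB.
  exact: (mbs_continuous D_model).
exact: mbs_f_continuous.
Qed.

Lemma mbs_samples_nonempty k : [set` chi k] !=set0.
Proof. by have [tau _ []] := mbs_quasi_uniform D_model k. Qed.

Lemma mbs_samples_sub k : [set` chi k] `<=` D k.
Proof. by have [tau _ []] := mbs_quasi_uniform D_model k. Qed.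

(* The error bound and omega k <= 1 give model k xs <= u k at a global
   minimizer xs, so the recursion never removes xs. *)
Lemma mbs_minimizer xs : Omega xs -> (forall x, Omega x -> f xs <= f x) ->
  forall k, D k xs.
Proof.
move=> Oxs xsmin; elim=> [|k IHk]; first by rewrite (mbs_init D_model).
rewrite (mbs_rec D_model); split => //.
have fxs : f xs <= fmin k.
  apply: minon_ge; first exact: mbs_samples_nonempty.
  by move=> x /mbs_samples_sub /mbs_sub; exact: xsmin.
have := mbs_error_pointwise IHk; rewrite ler_distl => /andP[_].
have /andP[w0 w1] := mbs_omega D_model k.
have /andP[mu _] := mbs_threshold D_model k.
have : omega k * (u k - fmin k) <= u k - fmin k by rewrite ler_piMl// subr_ge0.
(* With [m] the smallest sample, [model k xs <= f xs + omega k * (u k - m) <= m + (u k - m) = u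
   k]. *)
lra.
Qed.

End ModelBasedSequence.

Unset Implicit Arguments.
Set Strict Implicit.

Theorem mainTheorem3 (R : realType) (n : nat) (Omega : set 'rV[R]_n)
    (f : 'rV[R]_n -> R) (omega : nat -> R) (D : nat -> set 'rV[R]_n)
    (chi : nat -> {fset 'rV[R]_n}) (u : nat -> R)
    (A : nat -> {fset 'rV[R]_n * R} -> 'rV[R]_n -> R) (q : nat -> R)
    (Omega_nonempty : Omega !=set0)
    (Omega_closed : closed Omega)
    (Omega_diam : forall x y, Omega x -> Omega y -> norm2 (x - y) <= 1)
    (f_continuous : {within Omega, continuous f})
    (D_model : model_based_sequence Omega f omega D chi u A)
    (f_nonconstant : ~ exists c : R, forall x, Omega x -> f x = c)
    (q_pos : forall k, 0 < q k)
    (q_threshold : forall k,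
      u k - Num.min (minon (A k (samples f (chi k))) (D k))
                    (minon f [set` chi k])
        <= (1 + q k)^-1 *
           (maxon f [set` chi k] - minon f [set` chi k]))
    (omega_q : forall k, (1 + omega k) ^+ 2 < 1 + q k) :
  forall k,
    maxon (fun x => f x - minon f Omega) (D k.+1)
      <= (1 + omega k) ^+ 2 / (1 + q k) *
         maxon (fun x => f x - minon f Omega) (D k).
Proof.
have Oc : compact Omega by exact: closed_norm2_bounded_compact Omega_diam.
have [xs Oxs fsE] := minon_attained Omega_nonempty Oc f_continuous.
have xsmin x : Omega x -> f xs <= f x.
  by move=> Ox; rewrite -fsE; exact: minon_le.
move=> k; rewrite fsE.
have Dxs := mbs_minimizer Oc f_continuous D_model Oxs xsmin.
have err x := @mbs_error_pointwise _ _ _ _ _ _ _ _ _ Oc f_continuous D_model k x.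
have Dsub := mbs_sub D_model; have chisub := mbs_samples_sub D_model (k := k).
have chi0 := mbs_samples_nonempty D_model k.
have Dc := @mbs_compact _ _ _ _ _ _ _ _ _ Oc D_model k.
have fge x : D k x -> f x - f xs <= maxon (fun x => f x - f xs) (D k).
  move=> Dx; apply: (@maxon_ge _ _ _ (fun x => f x - f xs)) Dx => // y.
  by apply: cvgB; [exact: (mbs_f_continuous f_continuous D_model) | exact: cvg_cst].
have /andP[w0 _] := mbs_omega D_model k.
have /andP[mu uM] := mbs_threshold D_model k.
have fm : f xs <= minon f [set` chi k].
  by apply: minon_ge => // x /chisub /Dsub; exact: xsmin.
have fM : maxon f [set` chi k] <= maxon (fun x => f x - f xs) (D k) + f xs.
  by apply: maxon_le => // x /chisub /fge; rewrite lerBlDr.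
have Bxs : minon (A k (samples f (chi k))) (D k) <= A k (samples f (chi k)) xs.
  apply: minon_le => //; exact: (mbs_continuous D_model).
have := q_threshold k.
set a := minon (A k _) _ in Bxs *; set m := minon f _ in mu fm err *.
set M := maxon f _ in uM fM *; set S := maxon _ (D k) in fM *.
set B := Num.min a m => uB.
have [Ba Bm] : B <= a /\ B <= m by rewrite !ge_min !lexx orbT.
have q1 : 0 < 1 + q k by have := q_pos k; lra.
(* By [fm] and [fM] all samples lie between [f xs] and [f xs + S], so [M - m <= S]. *)
have MS : (1 + q k)^-1 * (M - m) <= (1 + q k)^-1 * S.
  by apply: ler_wpM2l; [rewrite invr_ge0 ltW | lra].
have uBS : u k - B <= (1 + q k)^-1 * S by exact: le_trans uB MS.
(* The minimizer [xs] survives into [D k.+1], which is therefore nonempty. *)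
apply: maxon_le; first by exists xs.
move=> x; rewrite (mbs_rec D_model) => -[Dx Ax].
have := err _ Dx; have := err _ (Dxs k).
rewrite !ler_distl => /andP[_ fxs] /andP[fx _].
(* [fx] and [Ax] bound [f x] above, [fxs] and [Bxs] bound [f xs] below. Passing from
   [1 + 2 * omega k] to the square adds [omega k ^+ 2 * (u k - B)], nonnegative because
   [B <= m <= u k]. *)
apply: (@le_trans _ _ ((1 + omega k) ^+ 2 * (u k - B))); first by nra.
by rewrite -mulrA ler_wpM2l ?sqr_ge0.
Qed.
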